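(* (1) Let $R$ be a ring and let $\mathcal{A}\subseteq \mathrm{Spec}(R)$ be a set of pairwise incomparable (with respect to inclusion) prime ideals which has the P.A-property for $R$. Then there exist a ring $T$ and a ring homomorphism $f:R\rightarrow T$ such that $\mathcal{A}=\{f^{-1}(M)\mid M\in \mathrm{Max}(T)\}$. (2) Let $R$ and $T$ be rings and $f:R\rightarrow T$ a ring homomorphism. Let $\mathcal{A}=\{f^{-1}(M)\mid M\in \mathrm{Max}(T)\}$ and $X=R\setminus \bigcup_{P\in\mathcal{A}} P$. Then $\mathcal{A}$ has the P.A-property for $R$ if and only if for each ideal $I$ of $R$ with $I\cap X=\emptyset$, the ideal $I^e$ is proper in $T$. Moreover, in this case $f$ can be extended to a ring homomorphism from $R_X$ to $T$.
   Context: All rings are commutative with $1\neq 0$ and all ring homomorphisms are unital. A set $\mathcal{A}\subseteq \mathrm{Spec}(R)$ has the P.A-property (prime avoidance property) for $R$ if whenever an ideal $I$ of $R$ satisfies $I\subseteq\bigcup_{P\in\mathcal{A}}P$, there exists $P\in\mathcal{A}$ with $I\subseteq P$. $\mathrm{Max}(T)$ is the set of maximal ideals of $T$. For an ideal $I$ of $R$ and a ring homomorphism $f:R\to T$, $I^e=f(I)T$ is the ideal of $T$ generated by $f(I)$. $R_X$ is the localization of $R$ at the multiplicatively closed set $X$; that $f$ extends to $R_X$ means that there is a ring homomorphism $R_X\to T$ whose composition with the canonical map $R\to R_X$ is $f$.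
   Formalization: In part (1) the set 𝒜 is assumed nonempty: the empty set has the P.A-property vacuously, but a ring T with 1≠0 always has a maximal ideal, so the claim fails for 𝒜=∅. *)

(* Defs.v *)
From HB Require Import structures.
From mathcomp Require Export all_boot all_order all_algebra.
From mathcomp Require Export boolp classical_sets.
From mathcomp Require Import ring.

Set Implicit Arguments.
Unset Strict Implicit.
Unset Printing Implicit Defensive.

Import GRing.Theory.
Local Open Scope classical_set_scope.
Local Open Scope ring_scope.
Local Open Scope quotient_scope.

(* [ideal I] does not require [I] to be proper, unlike [idealr_closed] of
   ring_quotient. *)
Definition ideal (R : comNzRingType) (I : set R) : Prop :=
  [/\ I 0, forall x y, I x -> I y -> I (x + y) & forall a x, I x -> I (a * x)].

Definition proper_ideal_of (R : comNzRingType) (I : set R) : Prop :=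
  ideal I /\ I <> setT.

Definition Spec (R : comNzRingType) : set (set R) :=
  [set P | proper_ideal_of P /\ forall x y, P (x * y) -> P x \/ P y].

Definition Max (R : comNzRingType) : set (set R) :=
  [set M | proper_ideal_of M /\
           forall J, proper_ideal_of J -> M `<=` J -> J = M].

Arguments Spec R : clear implicits.
Arguments Max R : clear implicits.

(* No ideal is empty, so [PA_property set0] holds vacuously; but [set0] is never
   [Max_contractions f] (below), as a nonzero ring has a maximal ideal. *)
Definition PA_property (R : comNzRingType) (A : set (set R)) : Prop :=
  forall I : set R, ideal I -> I `<=` \bigcup_(P in A) P ->
    exists2 P, A P & I `<=` P.

Definition pairwise_incomparable (R : comNzRingType) (A : set (set R)) : Prop :=
  forall P Q, A P -> A Q -> P `<=` Q -> P = Q.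

Definition ideal_extension (R T : comNzRingType) (f : {rmorphism R -> T})
    (I : set R) : set T :=
  smallest (@ideal T) (f @` I).

Definition Max_contractions (R T : comNzRingType) (f : {rmorphism R -> T}) :
    set (set R) :=
  [set f @^-1` M | M in Max T].

Definition avoiding (R : comNzRingType) (A : set (set R)) : set R :=
  ~` \bigcup_(P in A) P.

(* The localization is only a [comPzRingType]: it is the zero ring when
   [0 \in X]. *)
Section Localization.
Variables (R : comNzRingType) (X : set R) (hX : mulr_closed [in X]).

Definition fracs := {p : R * R | p.2 \in X}.
HB.instance Definition _ := Choice.on fracs.
HB.instance Definition _ := SubType.on fracs.
Implicit Types x y z : fracs.

Definition frac_equiv x y : bool :=
  `[< exists2 u, u \in X &
      u * ((val x).1 * (val y).2) = u * ((val y).1 * (val x).2) >].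

Let X1 : 1 \in X. Proof. exact: hX.1. Qed.
Let XM u v : u \in X -> v \in X -> u * v \in X. Proof. exact: hX.2. Qed.

Fact frac_equiv_refl : reflexive frac_equiv.
Proof. by move=> x; apply/asboolP; exists 1. Qed.

Fact frac_equiv_sym : symmetric frac_equiv.
Proof. by move=> x y; apply/asboolP/asboolP => -[u Xu E]; exists u. Qed.

Fact frac_equiv_trans : transitive frac_equiv.
Proof.
move=> [[b t] /= Xt] [[a s] /= Xs] [[c w] /= Xw].
move=> /asboolP[u Xu /= E] /asboolP[v Xv /= F]; apply/asboolP.
exists (u * v * t) => /=; first by rewrite !XM.
have -> : u * v * t * (a * w) = v * w * (u * (a * t)) by ring.
have -> : u * v * t * (c * s) = u * s * (v * (c * t)) by ring.
by rewrite E -F; ring.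
Qed.

Canonical frac_equiv_equiv :=
  EquivRel frac_equiv frac_equiv_refl frac_equiv_sym frac_equiv_trans.

Definition localization := {eq_quot frac_equiv}.
HB.instance Definition _ : EqQuotient _ frac_equiv localization :=
  EqQuotient.on localization.
HB.instance Definition _ := Choice.on localization.

Definition mkfrac (a s : R) (Xs : s \in X) : fracs := exist _ (a, s) Xs.

Local Notation frac_class x := (@pi fracs _ x : localization).

Definition loc0 : localization := frac_class (mkfrac 0 X1).
Definition loc1 : localization := frac_class (mkfrac 1 X1).

Definition addfrac x y : fracs :=
  mkfrac ((val x).1 * (val y).2 + (val y).1 * (val x).2)
         (XM (valP x) (valP y)).
Definition oppfrac x : fracs := mkfrac (- (val x).1) (valP x).
Definition mulfrac x y : fracs :=
  mkfrac ((val x).1 * (val y).1) (XM (valP x) (valP y)).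

Definition addloc := lift_op2 localization addfrac.
Definition opploc := lift_op1 localization oppfrac.
Definition mulloc := lift_op2 localization mulfrac.

Lemma loc_reprP x :
  exists2 u, u \in X & u * ((val x).1 * (val (repr (frac_class x))).2)
                     = u * ((val (repr (frac_class x))).1 * (val x).2).
Proof.
have /eqmodP/asboolP // : x = repr (frac_class x) %[mod localization].
by rewrite reprK.
Qed.

Lemma pi_addloc : {morph \pi : x y / addfrac x y >-> addloc x y}.
Proof.
move=> x y; unlock addloc; apply/eqmodP/asboolP.
have [u Xu] := loc_reprP x; have [v Xv] := loc_reprP y.
move: (repr _) (repr _) => [[b t] Xt] [[d w] Xw].
case: x y => [[a s] Xs] [[c r] Xr] /= F E.
exists (u * v); rewrite ?XM //=.
transitivity (v * r * w * (u * (a * t)) + u * s * t * (v * (c * w))).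
  by ring.
by rewrite E F; ring.
Qed.
Canonical pi_addloc_morph := PiMorph2 pi_addloc.

Lemma pi_opploc : {morph \pi : x / oppfrac x >-> opploc x}.
Proof.
move=> x; unlock opploc; apply/eqmodP/asboolP.
have [u Xu] := loc_reprP x.
move: (repr _) => [[b t] Xt]; case: x => [[a s] Xs] /= E.
by exists u => //=; rewrite !mulNr !mulrN E.
Qed.
Canonical pi_opploc_morph := PiMorph1 pi_opploc.

Lemma pi_mulloc : {morph \pi : x y / mulfrac x y >-> mulloc x y}.
Proof.
move=> x y; unlock mulloc; apply/eqmodP/asboolP.
have [u Xu] := loc_reprP x; have [v Xv] := loc_reprP y.
move: (repr _) (repr _) => [[b t] Xt] [[d w] Xw].
case: x y => [[a s] Xs] [[c r] Xr] /= F E.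
exists (u * v); rewrite ?XM //=.
transitivity ((u * (a * t)) * (v * (c * w))); first by ring.
by rewrite E F; ring.
Qed.
Canonical pi_mulloc_morph := PiMorph2 pi_mulloc.

Lemma loc_eq x y :
  (val x).1 * (val y).2 = (val y).1 * (val x).2 ->
  frac_class x = frac_class y.
Proof. by move=> E; apply/eqmodP/asboolP; exists 1; rewrite ?E. Qed.

Fact addlocA : associative addloc.
Proof.
elim/quotW=> x; elim/quotW=> y; elim/quotW=> z; rewrite -!pi_addloc.
by apply: loc_eq => /=; ring.
Qed.

Fact addlocC : commutative addloc.
Proof.
elim/quotW=> x; elim/quotW=> y; rewrite -!pi_addloc.
by apply: loc_eq => /=; ring.
Qed.

Fact add0loc : left_id loc0 addloc.
Proof.
by elim/quotW=> x; rewrite /loc0 -pi_addloc; apply: loc_eq => /=; ring. Qed.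

Fact addNloc : left_inverse loc0 opploc addloc.
Proof.
by elim/quotW=> x; rewrite -pi_opploc -pi_addloc; apply: loc_eq => /=; ring.
Qed.

HB.instance Definition _ :=
  GRing.isZmodule.Build localization addlocA addlocC add0loc addNloc.

Fact mullocA : associative mulloc.
Proof.
elim/quotW=> x; elim/quotW=> y; elim/quotW=> z; rewrite -!pi_mulloc.
by apply: loc_eq => /=; ring.
Qed.

Fact mullocC : commutative mulloc.
Proof.
elim/quotW=> x; elim/quotW=> y; rewrite -!pi_mulloc.
by apply: loc_eq => /=; ring.
Qed.

Fact mul1loc : left_id loc1 mulloc.
Proof.
by elim/quotW=> x; rewrite /loc1 -pi_mulloc; apply: loc_eq => /=; ring. Qed.

Fact mullocDl : left_distributive mulloc addloc.
Proof.
elim/quotW=> x; elim/quotW=> y; elim/quotW=> z.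
rewrite -!(pi_addloc, pi_mulloc).
by apply: loc_eq => /=; ring.
Qed.

HB.instance Definition _ := GRing.Zmodule_isComPzRing.Build localization
  mullocA mullocC mul1loc mullocDl.

Definition to_loc (a : R) : localization := frac_class (mkfrac a X1).

Fact to_loc_is_zmod_morphism : zmod_morphism to_loc.
Proof.
move=> a b; pose x := mkfrac a X1; pose y := mkfrac b X1.
change (to_loc (a - b) = addloc (frac_class x) (opploc (frac_class y))).
by rewrite -pi_opploc -pi_addloc; apply: loc_eq => /=; ring.
Qed.

Fact to_loc_is_monoid_morphism : monoid_morphism to_loc.
Proof.
split=> [//|a b]; pose x := mkfrac a X1; pose y := mkfrac b X1.
change (to_loc (a * b) = mulloc (frac_class x) (frac_class y)).
by rewrite -pi_mulloc; apply: loc_eq => /=; ring.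
Qed.

HB.instance Definition _ :=
  GRing.isZmodMorphism.Build R localization to_loc to_loc_is_zmod_morphism.
HB.instance Definition _ :=
  GRing.isMonoidMorphism.Build R localization to_loc to_loc_is_monoid_morphism.

Definition extends_to_localization (T : comNzRingType)
    (f : {rmorphism R -> T}) : Prop :=
  exists g : {rmorphism localization -> T}, g \o to_loc =1 f.

End Localization.

Lemma proper_idealP (R : comNzRingType) (I : set R) :
  ideal I -> (I <> setT <-> ~ I 1).
Proof.
move=> [_ _ IM]; split=> [IT I1|I1 E]; last by apply: I1; rewrite E.
by apply: IT; apply/seteqP; split=> // x _; rewrite -(mulr1 x); apply: IM.
Qed.

Lemma Max_sub_Spec (R : comNzRingType) : Max R `<=` Spec R.
Proof.
move=> M [[idM prM] maxM]; split=> // x y Mxy.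
have [M0 MD MM] := idM.
have [|nMx] := pselect (M x); first by left.
right; pose J := [set z | exists m a, M m /\ z = m + a * x].
have idJ : ideal J.
  split=> [|_ _ [m [a [Mm ->]]] [n [b [Mn ->]]]|c _ [m [a [Mm ->]]]].
  - by exists 0, 0; split=> //; ring.
  - by exists (m + n), (a + b); split; [exact: MD | ring].
  - by exists (c * m), (c * a); split; [exact: MM | ring].
have MJ : M `<=` J by move=> m Mm; exists m, 0; split=> //; ring.
have [m [a [Mm E]]] : J 1.
  apply: contrapT => nJ1; apply: nMx.
  rewrite -(maxM J) //; first by exists 0, 1; split=> //; ring.
  by split=> //; apply/proper_idealP.
have -> : y = y * m + a * (x * y).
  by rewrite -{1}(mulr1 y) E; ring.
by apply: MD; apply: MM.
Qed.

Lemma Max_contractions_sub_Spec (R T : comNzRingType) (f : {rmorphism R -> T}) :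
  Max_contractions f `<=` Spec R.
Proof.
move=> _ [M /Max_sub_Spec[[idM prM] primeM] <-].
have [M0 MD MM] := idM.
have idP : ideal (f @^-1` M).
  split=> [|x y|a x] /=; first by rewrite rmorph0.
  - by rewrite rmorphD; apply: MD.
  - by rewrite rmorphM; apply: MM.
split; last by move=> x y /=; rewrite rmorphM; apply: primeM.
split=> //; apply/(proper_idealP idP) => /=; rewrite rmorph1.
exact/(proper_idealP idM).
Qed.

Lemma avoiding_mulr_closed (R : comNzRingType) (A : set (set R)) :
  A `<=` Spec R -> mulr_closed [in avoiding A].
Proof.
move=> AS; split=> [|x y]; rewrite !inE.
  by move=> [P AP P1]; have [[idP /(proper_idealP idP)]] := AS P AP.
move=> nx ny [P AP Pxy]; have [_ /(_ _ _ Pxy)[Px|Py]] := AS P AP.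
- by apply: nx; exists P.
- by apply: ny; exists P.
Qed.

Definition avoiding_Max_contractions_mulr_closed (R T : comNzRingType)
    (f : {rmorphism R -> T}) : mulr_closed [in avoiding (Max_contractions f)] :=
  avoiding_mulr_closed (@Max_contractions_sub_Spec R T f).

(* Main.v *)
Require Import Defs.
From HB Require Import structures.
From mathcomp Require Import all_boot all_order all_algebra.
From mathcomp Require Import boolp classical_sets.
From mathcomp Require Import ring.

Set Implicit Arguments.
Unset Strict Implicit.
Unset Printing Implicit Defensive.

Import GRing.Theory.
Local Open Scope classical_set_scope.
Local Open Scope ring_scope.
Local Open Scope quotient_scope.

(** For the first part, [T] is the localization [R_X] of [R] at the complement
[X] of the union of [A]. An ideal of [R] survives in [R_X] exactly when it
misses [X], that is, when it lies in that union, and prime avoidance then puts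
it inside a single member of [A]. So the contraction of any proper ideal of
[R_X] is contained in some [P] in [A], and the proper ideals of [R_X] all lie
below the localized primes [P R_X], whose contractions are the [P] themselves.
Incomparability of the members of [A] makes these localized primes pairwise
incomparable as well, so they are the maximal ideals of [R_X]
([Max_contractions_localization]).

For the second part, extension of ideals is left adjoint to contraction, so [I]
lies in the contraction of a maximal ideal [M] exactly when its extension lies
in [M]. By Zorn's lemma an ideal lies in some maximal ideal exactly when it is
proper ([proper_ideal_sub_Max]), and this turns prime avoidance for the
contractions into the stated condition on extensions ([PA_propertyP]). Finally,
an element of [R] outside all contractions is sent outside all maximal ideals
of [T], hence to an invertible element, and [f] factors through [R_X] by the
universal property ([extends_to_localization_inverting]). *)

(** * Ideals, their extensions and maximal ideals *)

Lemma ideal_preimage (R T : comNzRingType) (f : {rmorphism R -> T})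
    (J : set T) :
  ideal J -> ideal (f @^-1` J).
Proof.
move=> [J0 JD JM]; split=> [|x y|a x] /=; first by rewrite rmorph0.
  by rewrite rmorphD; apply: JD.
by rewrite rmorphM; apply: JM.
Qed.

Lemma ideal_ideal_extension (R T : comNzRingType) (f : {rmorphism R -> T})
    (I : set R) :
  ideal (ideal_extension f I).
Proof.
split=> [J [[J0 _ _] _] //|x y Ex Ey J fJ|a x Ex J fJ].
  by have [[_ JD _] _] := fJ; apply: JD; [exact: Ex | exact: Ey].
by have [[_ _ JM] _] := fJ; apply: JM; exact: Ex.
Qed.

(** The adjunction between extension and contraction. *)
Lemma ideal_extension_subP (R T : comNzRingType) (f : {rmorphism R -> T})
    (I : set R) (J : set T) :
  ideal J -> (ideal_extension f I `<=` J <-> I `<=` f @^-1` J).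
Proof.
move=> idJ; split=> [EJ x Ix|IJ].
  by apply: EJ; apply: sub_gen_smallest; exists x.
by apply: smallest_sub => // _ [x Ix <-]; apply: IJ.
Qed.

Lemma proper_ideal_sub (R : comNzRingType) (I J : set R) :
  ideal I -> proper_ideal_of J -> I `<=` J -> proper_ideal_of I.
Proof.
move=> idI [idJ /(proper_idealP idJ) nJ1] IJ; split=> //.
by apply/(proper_idealP idI) => /IJ.
Qed.

Lemma disjoint_avoidingP (R : comNzRingType) (A : set (set R)) (I : set R) :
  I `&` avoiding A = set0 <-> I `<=` \bigcup_(P in A) P.
Proof. by rewrite /avoiding -setDE setD_eq0. Qed.

(** Zorn's lemma is applied to the sets [J] for which [I `|` J] is a proper
ideal, not to the proper ideals containing [I]: the union of the empty chain is
then covered too, since it gives back [I]. *)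
Lemma proper_ideal_sub_Max (R : comNzRingType) (I : set R) :
  proper_ideal_of I -> exists2 M, Max R M & I `<=` M.
Proof.
move=> prI; pose good J := proper_ideal_of (I `|` J).
have [F Fgood Ftot|M [prM maxM]] := @Zorn_bigcup R good.
  (* Adjoining [set0] to the chain makes every element of [I `|` \bigcup F]
     belong to [I `|` J] for one [J] of a nonempty chain. *)
  pose G := F `|` [set set0].
  have Ggood J : G J -> good J.
    by case=> [/Fgood //|->]; rewrite /good setU0.
  have Gtot J K : G J -> G K -> J `<=` K \/ K `<=` J.
    by move=> [FJ|->] [FK|->]; [exact: Ftot | right | left | left].
  have inG x : (I `|` \bigcup_(J in F) J) x -> exists2 J, G J & (I `|` J) x.
    move=> [Ix|[J FJ Jx]]; first by exists set0; [right | left].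
    by exists J; [left | right].
  have Gin J x : G J -> (I `|` J) x -> (I `|` \bigcup_(K in F) K) x.
    by move=> [FJ|->] [Ix|Jx] //; [left | right; exists J | left].
  have idU : ideal (I `|` \bigcup_(J in F) J).
    split=> [|x y /inG[J GJ Jx] /inG[K GK Ky]|a x /inG[J GJ Jx]].
    - by left; have [[]] := prI.
    - have [JK|KJ] := Gtot _ _ GJ GK.
        have [[_ KD _] _] := Ggood _ GK.
        by apply: (Gin K) => //; apply: KD => //; exact: (setUS JK).
      have [[_ JD _] _] := Ggood _ GJ.
      by apply: (Gin J) => //; apply: JD => //; exact: (setUS KJ).
    - by have [[_ _ JM] _] := Ggood _ GJ; apply: (Gin J) => //; apply: JM.
  split=> //; apply/(proper_idealP idU) => /inG[J GJ].
  by have [idJ /(proper_idealP idJ)] := Ggood _ GJ.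
exists (I `|` M); last exact: subsetUl.
split=> // J prJ IMJ; apply/seteqP; split=> // x Jx; apply: contrapT => nIMx.
apply: (maxM J); last by rewrite /good setUidr // => y Iy; apply: IMJ; left.
split=> [y My|JM]; first by apply: IMJ; right.
by apply: nIMx; right; apply: JM.
Qed.

(** Otherwise the principal ideal generated by [x] would be proper, hence
contained in a maximal ideal. *)
Lemma invertible_outside_Max (R : comNzRingType) (x : R) :
  (forall M, Max R M -> ~ M x) -> exists y, x * y = 1.
Proof.
move=> nMx; apply: contrapT => nUx.
pose I := [set z | exists y, z = x * y].
have idI : ideal I.
  split=> [|_ _ [y ->] [z ->]|a _ [y ->]].
  - by exists 0; ring.
  - by exists (y + z); ring.
  - by exists (a * y); ring.
have [|M maxM IM] := @proper_ideal_sub_Max R I.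
  by split=> //; apply/(proper_idealP idI) => -[y E]; apply: nUx; exists y.
by apply: (nMx M) => //; apply: IM; exists 1; ring.
Qed.

(** Both conditions say that an ideal covered by the contractions has its
extension inside a maximal ideal of [T]. *)
Lemma PA_propertyP (R T : comNzRingType) (f : {rmorphism R -> T}) :
  PA_property (Max_contractions f) <->
  (forall I : set R, ideal I ->
     I `&` avoiding (Max_contractions f) = set0 ->
     proper_ideal_of (ideal_extension f I)).
Proof.
split=> [PA I idI /disjoint_avoidingP /(PA I idI)[_ [M maxM <-]]|ext I idI].
  have [prM _] := maxM; have [idM _] := prM.
  move=> /(ideal_extension_subP _ _ idM).
  exact: (proper_ideal_sub (ideal_ideal_extension f I) prM).
move=> /disjoint_avoidingP /(ext I idI) /proper_ideal_sub_Max[M maxM EM].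
exists (f @^-1` M); first by exists M.
by apply/ideal_extension_subP => //; have [[]] := maxM.
Qed.

(** * Universal property of the localization *)

Section LocalizationTheory.
Variables (R : comNzRingType) (X : set R) (hX : mulr_closed [in X]).

Lemma mulr_closed1 : X 1.
Proof. by have := hX.1; rewrite inE. Qed.

Lemma mulr_closedM s t : X s -> X t -> X (s * t).
Proof. by move=> Xs Xt; have := hX.2 s t; rewrite !inE; apply. Qed.

Lemma to_loc_eqP a b :
  to_loc hX a = to_loc hX b <-> exists2 u, X u & u * a = u * b.
Proof.
split=> [/eqmodP/asboolP[u]|[u Xu E]].
  by rewrite inE /= !mulr1; exists u.
by apply/eqmodP/asboolP; exists u; rewrite ?inE //= !mulr1.
Qed.

(** Clearing a denominator: this describes each element of the localization
without choosing a representative of its class. *)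
Lemma localization_fracP (z : localization hX) :
  exists a s, X s /\ to_loc hX s * z = to_loc hX a.
Proof.
elim/quotW: z => -[[a s] /= Xs]; exists a, s; split; first by rewrite inE in Xs.
change (mulloc (to_loc hX s)
  (\pi_(localization hX) (exist _ (a, s) Xs)) = to_loc hX a).
by rewrite /to_loc -pi_mulloc; apply: loc_eq => /=; ring.
Qed.

Lemma to_loc_invertible s : X s -> exists z, to_loc hX s * z = 1.
Proof.
move=> Xs; have Xs' : s \in X by rewrite inE.
exists (\pi_(localization hX) (mkfrac 1 Xs')).
change (mulloc (to_loc hX s)
  (\pi_(localization hX) (mkfrac 1 Xs')) = to_loc hX 1).
by rewrite /to_loc -pi_mulloc; apply: loc_eq => /=; ring.
Qed.

(** The extension sends [z], with [s z = a] for some [s] in [X], to the unique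
solution [y] of [f s * y = f a]. Defining it by this relation spares any
computation with inverses: it is enough that the relation is functional and
compatible with the ring operations. *)
Lemma extends_to_localization_inverting (T : comNzRingType)
    (f : {rmorphism R -> T}) :
  (forall s, X s -> exists t, f s * t = 1) ->
  extends_to_localization hX f.
Proof.
move=> fX.
have fI s x y : X s -> f s * x = f s * y -> x = y.
  move=> /fX[t st1] E.
  by rewrite -[x]mul1r -[y]mul1r -st1 ![_ * t]mulrC -!mulrA E.
have f_to_loc a b : to_loc hX a = to_loc hX b -> f a = f b.
  by move=> /to_loc_eqP[u Xu E]; apply: (fI u) => //; rewrite -!rmorphM E.
pose graph z y :=
  exists a s, [/\ X s, to_loc hX s * z = to_loc hX a & f s * y = f a].
have graph_fun z y y' : graph z y -> graph z y' -> y = y'.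
  move=> [a [s [Xs sz sy]]] [b [t [Xt tz ty]]].
  apply: (fI (s * t)); first exact: mulr_closedM.
  have -> : f (s * t) * y = f (t * a) by rewrite !rmorphM -sy /=; ring.
  have -> : f (s * t) * y' = f (s * b) by rewrite !rmorphM -ty /=; ring.
  by apply: f_to_loc; rewrite !rmorphM /= -sz -tz mulrCA.
have graph_total z : exists y, graph z y.
  have [a [s [Xs sz]]] := localization_fracP z; have [t st1] := fX s Xs.
  by exists (t * f a), a, s; split=> //; rewrite mulrA st1 mul1r.
have graph_to_loc a : graph (to_loc hX a) (f a).
  by exists a, 1; rewrite !rmorph1 !mul1r; split=> //; exact: mulr_closed1.
have graphB z w x y : graph z x -> graph w y -> graph (z - w) (x - y).
  move=> [a [s [Xs sz sx]]] [b [t [Xt tw ty]]].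
  exists (t * a - s * b), (s * t); split; first exact: mulr_closedM.
    rewrite rmorphB !rmorphM /= -sz -tw mulrBr; congr (_ - _).
      by rewrite mulrCA mulrA.
    by rewrite mulrA.
  by rewrite rmorphB !rmorphM /= -sx -ty; ring.
have graphM z w x y : graph z x -> graph w y -> graph (z * w) (x * y).
  move=> [a [s [Xs sz sx]]] [b [t [Xt tw ty]]].
  exists (a * b), (s * t); split; first exact: mulr_closedM.
    by rewrite !rmorphM /= -sz -tw mulrACA.
  by rewrite !rmorphM /= -sx -ty; ring.
have [g gP] := choice graph_total.
have gB : zmod_morphism g.
  by move=> z w; apply: (graph_fun (z - w)); [exact: gP | exact: graphB].
have gM : monoid_morphism g.
  split; last first.
    by move=> z w; apply: (graph_fun (z * w)); [exact: gP | exact: graphM].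
  by rewrite -(rmorph1 f); apply: (graph_fun (to_loc hX 1)).
pose gm : {rmorphism localization hX -> T} :=
  HB.pack g (GRing.isZmodMorphism.Build _ _ g gB)
            (GRing.isMonoidMorphism.Build _ _ g gM).
by exists gm => a; apply: (graph_fun (to_loc hX a)); [exact: gP|].
Qed.

(** * Prime and maximal ideals of a nonzero localization *)

Hypothesis X0 : ~ X 0.

Fact localization_oner_neq0 : (1 : localization hX) != 0.
Proof.
apply/eqP; rewrite -(rmorph1 (to_loc hX)) -(rmorph0 (to_loc hX)).
by move=> /to_loc_eqP[u Xu]; rewrite mulr1 mulr0 => u0; case: X0; rewrite -u0.
Qed.

Definition nz_localization : comNzRingType :=
  HB.pack (localization hX)
    (GRing.PzSemiRing_isNonZero.Build (localization hX) localization_oner_neq0).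

Definition to_nz_localization : {rmorphism R -> nz_localization} := to_loc hX.

Local Notation L := nz_localization.
Local Notation toL := to_nz_localization.

Definition localized_ideal (P : set R) : set L :=
  [set z | exists p s, [/\ P p, X s & toL s * z = toL p]].

Lemma ideal_localized_ideal P : ideal P -> ideal (localized_ideal P).
Proof.
move=> [P0 PD PM].
split=> [|z w [p [s [Pp Xs sz]]] [q [t [Pq Xt tw]]]|z w [q [t [Pq Xt tw]]]].
- exists 0, 1; split=> //; first exact: mulr_closed1.
  by rewrite mulr0 rmorph0.
- exists (t * p + s * q), (s * t); split.
  + by apply: PD; apply: PM.
  + exact: mulr_closedM.
  + by rewrite rmorphD !rmorphM -sz -tw /=; ring.
- have [a [s [Xs sz]]] := localization_fracP z.
  exists (a * q), (s * t); split; [exact: PM | exact: mulr_closedM |].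
  by rewrite !rmorphM -tw [toL a](esym sz) /=; ring.
Qed.

(** If [a] becomes [p / s] in the localization, then [u s a = u p] for some [u]
in [X]; as [u s] is in [X], it is not in [P], so primality gives [a] in [P]. *)
Lemma preimage_localized_ideal P :
  Spec R P -> P `&` X = set0 -> toL @^-1` localized_ideal P = P.
Proof.
move=> [[[_ _ PM] _] primeP] PX; apply/seteqP; split=> [a|a Pa] /=; last first.
  by exists a, 1; split=> //; [exact: mulr_closed1 | rewrite rmorph1 mul1r].
move=> [p [s [Pp Xs]]]; rewrite -rmorphM => /to_loc_eqP[u Xu E].
have XnP t : X t -> ~ P t by move=> Xt Pt; suff: set0 t by []; rewrite -PX.
have /primeP[/XnP|] // : P ((u * s) * a) by rewrite -mulrA E; exact: PM.
by case; exact: mulr_closedM.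
Qed.

(** Multiplying [z] by its denominator stays in [J] and gives the image of an
element of [R]; so inclusions of ideals can be tested on contractions. *)
Lemma sub_localized_ideal (J : set L) :
  ideal J -> J `<=` localized_ideal (toL @^-1` J).
Proof.
move=> [_ _ JM] z Jz; have [a [s [Xs sz]]] := localization_fracP z.
by exists a, s; split=> //=; rewrite -[toL a]sz; exact: JM.
Qed.

Lemma localized_idealS P Q :
  P `<=` Q -> localized_ideal P `<=` localized_ideal Q.
Proof. by move=> PQ z [p [s [/PQ Qp Xs sz]]]; exists p, s. Qed.

Lemma preimage_proper_disjoint (J : set L) :
  proper_ideal_of J -> toL @^-1` J `&` X = set0.
Proof.
move=> [idJ /(proper_idealP idJ) nJ1]; apply/seteqP; split=> // s [/= Js Xs].
have [_ _ JM] := idJ; have [t st1] := to_loc_invertible Xs.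
by apply: nJ1; rewrite -[1]st1 mulrC; exact: (JM t).
Qed.

Lemma proper_localized_ideal P :
  Spec R P -> P `&` X = set0 -> proper_ideal_of (localized_ideal P).
Proof.
move=> PS PX; have [[idP /(proper_idealP idP) nP1] _] := PS.
have idL := ideal_localized_ideal idP; split=> //.
apply/(proper_idealP idL) => L1; apply: nP1.
by rewrite -(preimage_localized_ideal PS PX) /= rmorph1.
Qed.

(** Every proper ideal of the localization lies in some localized [P], as its
contraction misses [X]. A maximal ideal is therefore equal to a localized [P];
conversely, a proper ideal above the localization of [P] lies in that of some
[Q] in [A], and contracting gives [P `<=` Q], so [P = Q] by incomparability. *)
Lemma Max_contractions_localization (A : set (set R)) :
    A `<=` Spec R -> (forall P, A P -> P `&` X = set0) ->
    pairwise_incomparable A ->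
    (forall I, ideal I -> I `&` X = set0 -> exists2 P, A P & I `<=` P) ->
  Max_contractions toL = A.
Proof.
move=> AS AX incA AP.
have below J : proper_ideal_of J -> exists2 P, A P & toL @^-1` J `<=` P.
  move=> prJ; apply: AP; last exact: preimage_proper_disjoint.
  by apply: ideal_preimage; have [] := prJ.
apply/seteqP; split=> [_ [M [prM maxM] <-]|P aP].
  have [P aP MP] := below _ prM.
  rewrite -(maxM (localized_ideal P)).
  - by rewrite preimage_localized_ideal //; [exact: AS | exact: AX].
  - by apply: proper_localized_ideal; [exact: AS | exact: AX].
  - apply: subset_trans (localized_idealS MP).
    by apply: sub_localized_ideal; have [] := prM.
have preP := preimage_localized_ideal (AS _ aP) (AX _ aP).
exists (localized_ideal P); last exact: preP.
split=> [|J prJ PJ].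
  by apply: proper_localized_ideal; [exact: AS | exact: AX].
have [Q aQ JQ] := below _ prJ.
have PQ : P = Q.
  by apply: incA => //; rewrite -{1}preP => a /PJ; exact: JQ.
apply/seteqP; split=> //; rewrite PQ.
apply: subset_trans (localized_idealS JQ).
by apply: sub_localized_ideal; have [] := prJ.
Qed.

End LocalizationTheory.

Theorem theorem2p3 :
  (forall (R : comNzRingType) (A : set (set R)),
      A !=set0 ->
      A `<=` Spec R ->
      pairwise_incomparable A ->
      PA_property A ->
      exists (T : comNzRingType) (f : {rmorphism R -> T}),
        A = Max_contractions f)
  /\
  (forall (R T : comNzRingType) (f : {rmorphism R -> T}),
      (PA_property (Max_contractions f) <->
       (forall I : set R, ideal I ->
          I `&` avoiding (Max_contractions f) = set0 ->
          proper_ideal_of (ideal_extension f I)))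
      /\
      (PA_property (Max_contractions f) ->
       extends_to_localization (avoiding_Max_contractions_mulr_closed f) f)).
Proof.
split=> [R A [P0 AP0] AS incA PA|R T f].
  (* A member of [A] exists and contains 0, so the localization is nonzero. *)
  have X0 : ~ avoiding A 0.
    by apply; exists P0 => //; have [[[]]] := AS _ AP0.
  exists (@nz_localization R _ (avoiding_mulr_closed AS) X0).
  exists (@to_nz_localization R _ (avoiding_mulr_closed AS) X0).
  apply/esym/Max_contractions_localization => // [P AP|I idI].
    by apply/disjoint_avoidingP => x Px; exists P.
  by move=> /disjoint_avoidingP; exact: PA.
split=> [|_]; first exact: PA_propertyP.
apply: extends_to_localization_inverting => s Xs.
apply: invertible_outside_Max => M maxM Ms.
by apply: Xs; exists (f @^-1` M) => //; exists M.
Qed.
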